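(* Let $K$ be a separable metric space and let $f,g$ be bounded real-valued functions on $K$ of finite Baire index. Let $h$ be any of the functions $f+g$, $f\cdot g$, $\max\{f,g\}$, $\min\{f,g\}$. Then $$i(h)\le i(f)+i(g).$$
   Context: Let $K$ be a (non-empty) separable metric space. For a bounded function $f$ on a metric space $L$, put $\underline{\mathrm{osc}}\,f(x)=\limsup_{y\to x}|f(y)-f(x)|$ and $\mathrm{osc}\,f(x)=\limsup_{y\to x}\underline{\mathrm{osc}}\,f(y)$, where limsups are non-exclusive ($y=x$ allowed), i.e. $\limsup_{y\to x}g(y)=\inf_U\sup_{y\in U}g(y)$ over open neighborhoods $U$ of $x$ in $L$. For bounded $f:K\to\mathbb{R}$ and $\varepsilon>0$, let $\mathrm{os}_0(f,\varepsilon)=K$ and, inductively, $\mathrm{os}_{j+1}(f,\varepsilon)=\{x\in L:\mathrm{osc}(f|_L)(x)\ge\varepsilon\}$ where $L=\mathrm{os}_j(f,\varepsilon)$ (oscillation computed in the subspace $L$). Set $i(f,\varepsilon)=\sup\{n:\mathrm{os}_n(f,\varepsilon)\ne\emptyset\}\in\{0,1,2,\dots\}\cup\{\infty\}$. A bounded function $f$ is of finite Baire index if there is an $n$ with $\mathrm{os}_n(f,\varepsilon)=\emptyset$ for all $\varepsilon>0$. The oscillation index is $i(f)=\sup_{\varepsilon>0}i(f,\varepsilon)$, which is finite (and a maximum) exactly when $f$ is of finite Baire index. *)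

(* Defs.v *)
From mathcomp Require Import all_boot all_order all_algebra.
From mathcomp Require Import all_classical all_reals all_analysis.

Set Implicit Arguments.
Unset Strict Implicit.
Unset Printing Implicit Defensive.

Import Order.TTheory GRing.Theory Num.Theory.
Import numFieldNormedType.Exports.

Local Open Scope classical_set_scope.
Local Open Scope ring_scope.

Definition separable_space (T : topologicalType) : Prop :=
  exists2 D : set T, countable D & dense D.

Section oscillation.
Context {R : realType} {K : metricType R}.
Implicit Types (f : K -> R) (L : set K) (eps : R).

(* A subspace of K is represented by its carrier L : set K.  For x in L,
   [within L (nbhs x)] is the filter of neighborhoods of x in L; as it is not
   the punctured filter x^', the point x itself is allowed in the limsups. *)
Definition lower_osc L f (x : K) : \bar R :=
  limf_esup (fun y => `|f y - f x|%:E) (within L (nbhs x)).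

Definition osc L f (x : K) : \bar R :=
  limf_esup (lower_osc L f) (within L (nbhs x)).

Fixpoint os (j : nat) f eps : set K :=
  if j is j'.+1 then
    let L := os j' f eps in [set x | L x /\ (eps%:E <= osc L f x)%E]
  else setT.

(* The indices are extended reals, so that they may be +oo.  For empty K,
   [osc_index_eps] is -oo. *)
Definition osc_index_eps f eps : \bar R :=
  ereal_sup [set (n%:R)%:E | n in [set n : nat | os n f eps !=set0]].

Definition osc_index f : \bar R :=
  ereal_sup [set osc_index_eps f eps | eps in [set eps : R | 0 < eps]].

Definition finite_Baire_index f : Prop :=
  exists n : nat, forall eps, 0 < eps -> os n f eps = set0.

End oscillation.

(* Main.v *)
(** Fix [delta] and write [A_i], [B_k] for the sets [os_i(f, delta)],
    [os_k(g, delta)], which are closed and decreasing.  If [x] lies in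
    [A_i ∩ B_k] but not in [A_(i+1) ∪ B_(k+1)], then near [x] the set
    [H_j], the union of the [A_i' ∩ B_k'] with [i' + k' = j := i + k],
    coincides with [A_i ∩ B_k], on which the oscillations of [f] and [g] at
    [x] are less than [delta].  Since the increments of [h] are bounded by
    [C] times those of [f] and [g], induction on [j] gives
    [os_j(h, eps) ⊆ H_j] for [delta] small with respect to [eps]. *)

Require Import Defs.
From mathcomp Require Import all_boot all_order all_algebra.
From mathcomp Require Import all_classical all_reals all_analysis.
From mathcomp Require Import ring lra.
Set Implicit Arguments.
Unset Strict Implicit.
Unset Printing Implicit Defensive.

Import Order.TTheory GRing.Theory Num.Theory.
Import numFieldNormedType.Exports.
Local Open Scope classical_set_scope.
Local Open Scope ring_scope.

Lemma limf_esup_lt (R : realType) (T : choiceType) (X : filteredType T)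
    (u : X -> \bar R) (F : set_system X) (e : \bar R) :
  (limf_esup u F < e)%E -> exists2 A, F A & (ereal_sup (u @` A) < e)%E.
Proof. by move=> /ereal_inf_lt[_ [A FA <-]] supA; exists A. Qed.

Lemma limf_esup_le (R : realType) (T : choiceType) (X : filteredType T)
    (u : X -> \bar R) (F : set_system X) (e : \bar R) (A : set X) :
  F A -> (forall y, A y -> (u y <= e)%E) -> (limf_esup u F <= e)%E.
Proof.
move=> FA uA; apply: (@le_trans _ _ (ereal_sup (u @` A))).
  by apply: ereal_inf_lbound; exists A.
by apply: ge_ereal_sup => _ [y Ay <-]; exact: uA.
Qed.

Section oscillation.
Variables (R : realType) (K : metricType R).
Implicit Types (f g h : K -> R) (L : set K).

Lemma osc_lt_near L f x (e : R) : (osc L f x < e%:E)%E ->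
  \forall y \near x, L y ->
    \forall z \near y, L z -> `|f z - f y| < e.
Proof.
move=> /limf_esup_lt[A nA supA].
apply: (@filterS _ (nbhs x) _ (fun y => L y -> A y)) nA => y LA Ly.
have /limf_esup_lt[B nB supB] : (lower_osc L f y < e%:E)%E.
  by apply: le_lt_trans supA; apply: ereal_sup_ubound; exists y => //; exact: LA.
apply: (@filterS _ (nbhs y) _ (fun z => L z -> B z)) nB => z LB Lz.
rewrite -lte_fin.
by apply: le_lt_trans supB; apply: ereal_sup_ubound; exists z => //; exact: LB.
Qed.

(** Upper semicontinuity of the oscillation: a neighborhood that witnesses the bound at [x]
    witnesses it at each of its interior points, whether or not they lie in [L]. *)
Lemma near_osc_lt L f x (e : \bar R) : (osc L f x < e)%E ->
  \forall y \near x, (osc L f y < e)%E.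
Proof.
move=> /limf_esup_lt[A nA supA].
move: (nbhs_interior nA); apply: filterS => y nyA; apply: le_lt_trans supA.
apply: (@limf_esup_le _ _ _ _ _ _ A) => // z Az.
by apply: ereal_sup_ubound; exists z.
Qed.

Lemma osc_le L f x (e : R) :
  (\forall y \near x, L y -> \forall z \near y, L z -> `|f z - f y| <= e) ->
  (osc L f x <= e%:E)%E.
Proof.
move=> nfe.
apply: (@limf_esup_le _ _ _ _ _ _
  (fun y => \forall z \near y, L z -> `|f z - f y| <= e)) => [//|y nfy].
apply: (@limf_esup_le _ _ _ _ _ _ (fun z => `|f z - f y| <= e)) => [//|z].
by rewrite lee_fin.
Qed.

Lemma os_nincr f (e : R) i j : (i <= j)%N -> os j f e `<=` os i f e.
Proof.
move=> /subnK <-; elim: (j - i)%N => [//|k IH] x.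
by rewrite addSn => -[/IH].
Qed.

(** Each [os j f e] is closed in [K], by induction on [j]: a point is excluded either at an earlier
    stage or by a small oscillation, and both are open conditions. *)
Lemma near_notin_os f (e : R) j x : ~ os j f e x ->
  \forall y \near x, ~ os j f e y.
Proof.
elim: j x => [x []//|j IH] x /= /not_andP[/IH|/negP].
  by apply: filterS => y nosy [].
by rewrite -ltNge => /near_osc_lt; apply: filterS => y + []; rewrite ltNge => /negP.
Qed.

Lemma notin_osS_near f (e : R) i x : os i f e x -> ~ os i.+1 f e x ->
  \forall y \near x, os i f e y ->
    \forall z \near y, os i f e z -> `|f z - f y| < e.
Proof.
move=> osx /not_andP[//|/negP]; rewrite -ltNge; exact: osc_lt_near.
Qed.

Lemma os_sub_bigcup f g h (C d e : R) :
  0 <= C -> 2 * C * d < e ->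
  (forall x y, `|h y - h x| <= C * (`|f y - f x| + `|g y - g x|)) ->
  forall j x, os j h e x ->
  exists i k, [/\ (i + k)%N = j, os i f d x & os k g d x].
Proof.
move=> C0 Cde hfg; elim=> [x _|j IH x [jx]]; first by exists 0, 0.
have [i [k [ikj fx gx]]] := IH _ jx.
(* If no pair of indices with sum [j.+1] fits [x], then the oscillation of [h] at [x] is below
   [e]. *)
apply: contraPP => noH; apply/negP; rewrite -ltNge.
have fSx : ~ os i.+1 f d x.
  by move=> fSx; apply: noH; exists i.+1, k; rewrite addSn ikj.
have gSx : ~ os k.+1 g d x.
  by move=> gSx; apply: noH; exists i, k.+1; rewrite addnS ikj.
apply: (@le_lt_trans _ _ (2 * C * d)%:E); last by rewrite lte_fin.
have nearH : \forall y \near x, os j h e y -> os i f d y /\ os k g d y.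
  apply: filterS2 (near_notin_os fSx) (near_notin_os gSx) => y fSy gSy.
  move=> /IH[i' [k' [ikj' fy gy]]].
  have i'i : (i' <= i)%N.
    by rewrite leqNgt; apply/negP => /os_nincr-/(_ f d y fy).
  have k'k : (k' <= k)%N.
    by rewrite leqNgt; apply/negP => /os_nincr-/(_ g d y gy).
  have ii' : (i <= i')%N.
    by rewrite -(leq_add2r k) ikj -ikj' leq_add2l.
  have kk' : (k <= k')%N.
    by rewrite -(leq_add2l i) ikj -ikj' leq_add2r.
  by split; [exact: os_nincr fy | exact: os_nincr gy].
apply: osc_le; have := nbhs_interior nearH.
apply: filterS3 (notin_osS_near fx fSx) (notin_osS_near gx gSx).
move=> y ny_f ny_g nyH jy.
have [/ny_f nfy /ny_g ngy] := nbhs_singleton nyH jy.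
apply: filterS3 nfy ngy nyH => z fzy gzy zH /zH[/fzy fd /gzy gd].
apply: le_trans (hfg y z) _.
rewrite [2 * C]mulrC -mulrA; apply: ler_wpM2l => //; lra.
Qed.

Lemma osc_index_ge f (e : R) n x : 0 < e -> os n f e x ->
  (n%:R%:E <= osc_index f)%E.
Proof.
move=> e0 nx; apply: (@le_trans _ _ (osc_index_eps f e)).
  by apply: ereal_sup_ubound; exists n => //; exists x.
by apply: ereal_sup_ubound; exists e.
Qed.

Lemma osc_index_le_add f g h (C : R) : 0 < C ->
  (forall x y, `|h y - h x| <= C * (`|f y - f x| + `|g y - g x|)) ->
  (osc_index h <= osc_index f + osc_index g)%E.
Proof.
move=> C0 hfg; apply: ge_ereal_sup => _ [e /= e0 <-].
apply: ge_ereal_sup => _ [n [x nx] <-].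
have d0 : 0 < e / (4 * C) by rewrite divr_gt0// mulr_gt0.
have Cde : 2 * C * (e / (4 * C)) < e.
  have -> : 2 * C * (e / (4 * C)) = e / 2 by field; rewrite gt_eqF.
  lra.
have [i [k [<- fx gx]]] := os_sub_bigcup (ltW C0) Cde hfg nx.
by rewrite natrD EFinD leeD// ?(osc_index_ge d0 fx)// (osc_index_ge d0 gx).
Qed.

End oscillation.

Lemma dist_max_le (R : realDomainType) (a b c d : R) :
  `|Num.max a b - Num.max c d| <= `|a - c| + `|b - d|.
Proof.
have := ler_norm (a - c); have := ler_norm (b - d).
have := ler_norm (c - a); have := ler_norm (d - b).
rewrite (distrC c) (distrC d) ler_norml => *.
have := normr_ge0 (a - c); have := normr_ge0 (b - d) => *.
by case: (leP a b); case: (leP c d) => *; apply/andP; split; lra.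
Qed.

Lemma dist_min_le (R : realDomainType) (a b c d : R) :
  `|Num.min a b - Num.min c d| <= `|a - c| + `|b - d|.
Proof.
by have := dist_max_le (- a) (- b) (- c) (- d);
  rewrite -!oppr_min -!opprD !normrN.
Qed.

Lemma dist_mul_le (R : numDomainType) (C a b c d : R) :
  `|a| <= C -> `|d| <= C -> `|a * b - c * d| <= C * (`|a - c| + `|b - d|).
Proof.
move=> aC dC.
have -> : a * b - c * d = d * (a - c) + a * (b - d) by ring.
by rewrite (mulrDr C) (le_trans (ler_normD _ _))// !normrM lerD// ler_wpM2r.
Qed.

Theorem theorem1p3 (R : realType) (K : metricType R)
    (K_nonempty : [set: K] !=set0) (K_separable : separable_space K)
    (f g : K -> R)
    (f_bounded : bounded_fun f) (g_bounded : bounded_fun g)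
    (f_index : finite_Baire_index f) (g_index : finite_Baire_index g)
    (h : K -> R)
    (h_def : [\/ h = (fun x => f x + g x),
                 h = (fun x => f x * g x),
                 h = (fun x => Num.max (f x) (g x)) |
                 h = (fun x => Num.min (f x) (g x))]) :
  (osc_index h <= osc_index f + osc_index g)%E.
Proof.
case: h_def => ->.
- apply: (@osc_index_le_add _ _ _ _ _ 1) => // x y.
  by rewrite mul1r opprD addrACA ler_normD.
- have [M [M0 fM]] := ex_strict_bound_gt0 f_bounded.
  have [N [N0 gN]] := ex_strict_bound_gt0 g_bounded.
  apply: (@osc_index_le_add _ _ _ _ _ (M + N)) => [|x y]; first exact: addr_gt0.
  apply: dist_mul_le.
    by rewrite (le_trans (ltW (fM y I)))// lerDl ltW.
  by rewrite (le_trans (ltW (gN x I)))// lerDr ltW.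
- apply: (@osc_index_le_add _ _ _ _ _ 1) => // x y.
  by rewrite mul1r dist_max_le.
- apply: (@osc_index_le_add _ _ _ _ _ 1) => // x y.
  by rewrite mul1r dist_min_le.
Qed.
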